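(* Suppose $X$ is a vector space over $F$, $Y$ is a finite dimensional subspace, $T:X\rightarrow X$ is linear with $T(Y)\subset Y$, and $E_{1},E_{2},\ldots$ lie in $X$. Suppose further that $T(E_{j})=\sum_i v_{i,j}E_{i}+y_{j}$, where $V=|v_{i,j}|$ and $s$ are as described below, and $y_{1},y_{2},\ldots$ is a sequence in $Y$ such that for each $i$, $1\le i\le s$, each co-ordinate of $y_{i+sk}$ with respect to a fixed basis of $Y$ is an eventually polynomial function of $k$. Then if $l:X\rightarrow F$ is linear with each $l(E_{i})=0$, the power series $\sum_{n=0}^{\infty}l\left(T^{n}(E_{1})\right)z^{n}$ is in $\mathcal{L}$.
   Context: $F$ is a field and $s\ge 1$. $V=|v_{i,j}|$, $i,j\ge 1$, is an infinite matrix with entries in $F$ satisfying: (1) $v_{i,j}=0$ whenever $i\le s$ and $j>2s$, or $j\le s$ and $i>2s$; (2) $v_{i+s,j+s}=v_{i,j}$ whenever $i+j\ge s+2$; (3) the initial $2s$ by $2s$ block of $V$ is $\left(\begin{smallmatrix}D&C\\ A&B\end{smallmatrix}\right)$ with $A,B,C,D\in M_s(F)$. With these $A,B,C$, let $M_0,M_1,M_{-1}$ be the coefficients of $x^{0},x^{1},x^{-1}$ respectively in the element $\sum_{n\ge0}(Ax+B+Cx^{-1})^{n}z^{n}$ of $M_s(F)[x,x^{-1}][[z]]$ (equivalently, $M_i=\sum w(\alpha)z^{l(\alpha)}$ over all walks $\alpha$ with steps in $\{-1,0,1\}$ from $i$ to $0$, where $w(\alpha)$ is the ordered product of $A$, $B$,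 $C$ for steps $-1$, $0$, $1$). $\mathcal{L}$ denotes the extension field of $F(z)$, inside the field of fractions of $F[[z]]$, generated by the matrix entries of $M_0$, $M_1$, $M_{-1}$; it is a finite extension of $F(z)$. *)

(* Defs.v *)
From HB Require Import structures.
From mathcomp Require Import all_boot all_order all_algebra.
From mathcomp Require Import boolp classical_sets fsbigop.

Set Implicit Arguments.
Unset Strict Implicit.
Unset Printing Implicit Defensive.

Import GRing.Theory.
Local Open Scope ring_scope.

Record fps (F : fieldType) := Fps { fps_coef : nat -> F }.

HB.instance Definition _ (F : fieldType) := gen_eqMixin (fps F).
HB.instance Definition _ (F : fieldType) := gen_choiceMixin (fps F).

Section PowerSeries.
Variable F : fieldType.
Implicit Types f g h : fps F.

Lemma fpsP f g : (forall n, fps_coef f n = fps_coef g n) -> f = g.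
Proof. by case: f g => [f] [g] /= fg; congr Fps; apply/funext. Qed.

Definition fps_zero : fps F := Fps (fun=> 0).
Definition fps_add f g := Fps (fun n => fps_coef f n + fps_coef g n).
Definition fps_opp f := Fps (fun n => - fps_coef f n).

Fact fps_addA : associative fps_add.
Proof. by move=> f g h; apply: fpsP => n /=; rewrite addrA. Qed.
Fact fps_addC : commutative fps_add.
Proof. by move=> f g; apply: fpsP => n /=; rewrite addrC. Qed.
Fact fps_add0 : left_id fps_zero fps_add.
Proof. by move=> f; apply: fpsP => n /=; rewrite add0r. Qed.
Fact fps_addN : left_inverse fps_zero fps_opp fps_add.
Proof. by move=> f; apply: fpsP => n /=; rewrite addNr. Qed.

HB.instance Definition _ :=
  GRing.isZmodule.Build (fps F) fps_addA fps_addC fps_add0 fps_addN.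

Definition fps_poly (p : {poly F}) : fps F := Fps (fun n => p`_n).

Definition fps_one : fps F := fps_poly 1.
Definition fps_mul f g :=
  Fps (fun n => \sum_(i < n.+1) fps_coef f i * fps_coef g (n - i)).

Definition fps_trunc n f : {poly F} := \poly_(i < n) fps_coef f i.

Fact fps_mul_trunc m n f g : (n < m)%N ->
  fps_coef (fps_mul f g) n = (fps_trunc m f * fps_trunc m g)`_n.
Proof.
move=> nm; rewrite coefM /=; apply: eq_bigr => i _.
have im : (i < m)%N by apply: leq_trans nm; rewrite ltnS -ltnS ltn_ord.
by rewrite !coef_poly im (leq_ltn_trans (leq_subr _ _) nm).
Qed.

Fact fps_mulC : commutative fps_mul.
Proof.
by move=> f g; apply: fpsP => n; rewrite !(fps_mul_trunc _ _ (ltnSn n)) mulrC.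
Qed.

Fact fps_mulA : associative fps_mul.
Proof.
move=> f g h; apply: fpsP => n.
have tr m (p q q' : {poly F}) : (forall i, (i <= m)%N -> q`_i = q'`_i) ->
    (p * q)`_m = (p * q')`_m.
  by move=> qq; rewrite !coefM; apply: eq_bigr => i _; rewrite qq ?leq_subr.
rewrite !(fps_mul_trunc _ _ (ltnSn n)).
rewrite (tr n _ _ (fps_trunc n.+1 g * fps_trunc n.+1 h)); last first.
  move=> i le_in; rewrite coef_poly ltnS le_in.
  by apply: fps_mul_trunc; rewrite ltnS.
rewrite mulrA mulrC (mulrC (fps_trunc _ (fps_mul _ _))); apply: tr => i le_in.
rewrite coef_poly ltnS le_in; apply/esym.
by apply: fps_mul_trunc; rewrite ltnS.
Qed.

Fact fps_mul1 : left_id fps_one fps_mul.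
Proof.
move=> f; apply: fpsP => n /=; rewrite big_ord_recl /= coef1 mul1r subn0.
by rewrite big1 ?addr0 // => i _; rewrite coef1 mul0r.
Qed.

Fact fps_mulDl : left_distributive fps_mul fps_add.
Proof.
move=> f g h; apply: fpsP => n /=; rewrite -big_split /=.
by apply: eq_bigr => i _; rewrite mulrDl.
Qed.

Fact fps_one_neq0 : fps_one != 0 :> fps F.
Proof.
apply/eqP => /(congr1 (fun f => fps_coef f 0)) /=.
by rewrite coef1 => /eqP; rewrite oner_eq0.
Qed.

HB.instance Definition _ := GRing.Zmodule_isComNzRing.Build (fps F)
  fps_mulA fps_mulC fps_mul1 fps_mulDl fps_one_neq0.

Definition fps_unit : pred (fps F) := fun f => `[< exists g, g * f = 1 >].
Definition fps_inv f : fps F := xget f [set g | g * f = 1]%classic.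

Fact fps_mulV : {in fps_unit, left_inverse 1 fps_inv *%R}.
Proof.
by move=> f /asboolP uf; apply: (xgetPex f (P := [set g | g * f = 1]%classic)).
Qed.
Fact fps_unitPl f g : g * f = 1 -> fps_unit f.
Proof. by move=> gf; apply/asboolP; exists g. Qed.
Fact fps_inv_out : {in [predC fps_unit], fps_inv =1 id}.
Proof.
move=> f /negP nf; apply: xgetPN => g gf; apply: nf; exact: fps_unitPl gf.
Qed.

HB.instance Definition _ := GRing.ComNzRing_hasMulInverse.Build (fps F)
  fps_mulV fps_unitPl fps_inv_out.

Fact fps_neq0P f : f != 0 ->
  exists2 n, fps_coef f n != 0 & forall m, (m < n)%N -> fps_coef f m = 0.
Proof.
move=> f0; have e : exists n, fps_coef f n != 0.
  apply: contrapT => ne; move/eqP: f0; apply; apply: fpsP => n.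
  by apply/eqP/negPn/negP => fn; apply: ne; exists n.
case: (ex_minnP e) => n fn min_n; exists n => // m mn; apply/eqP/negPn/negP.
by move=> /min_n; rewrite leqNgt mn.
Qed.

Fact fps_idomain : GRing.integral_domain_axiom (fps F).
Proof.
move=> f g fg; apply/norP => -[/fps_neq0P[m fm0 fm] /fps_neq0P[n gn0 gn]].
have /= := congr1 (fun h => fps_coef h (m + n)) fg.
have lt_m : (m < (m + n).+1)%N by rewrite ltnS leq_addr.
rewrite (bigD1 (Ordinal lt_m)) //= addKn big1 => [|i im].
  by rewrite addr0 => /eqP; rewrite mulf_eq0 (negPf fm0) (negPf gn0).
have {}im : (i : nat) != m by [].
have [lt_im|le_mi] := ltnP i m; first by rewrite fm ?mul0r.
rewrite gn ?mulr0 // -(ltn_add2l i) subnKC; last by rewrite -ltnS ltn_ord.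
by rewrite ltn_add2r ltn_neqAle eq_sym im.
Qed.

HB.instance Definition _ :=
  GRing.ComUnitRing_isIntegral.Build (fps F) fps_idomain.

End PowerSeries.

(* A walk of length n is the sequence of its steps.  The element k of 'I_3
   encodes the step k - 1, so that -1, 0, 1 have weights A, B, C. *)

Definition step (k : 'I_3) : int := k%:Z - 1.

Definition step_weight (F : fieldType) (s : nat) (A B C : 'M[F]_s) (k : 'I_3)
  : 'M[F]_s :=
  match val k with 0%N => A | 1%N => B | _ => C end.

Definition walk_weight (F : fieldType) (s n : nat) (A B C : 'M[F]_s)
    (w : n.-tuple 'I_3) : 'M[F]_s :=
  \prod_(k <- w) step_weight A B C k.

Definition walk_sum (F : fieldType) (s : nat) (A B C : 'M[F]_s) (i : int)
    (n : nat) : 'M[F]_s :=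
  \sum_(w : n.-tuple 'I_3 | i + \sum_(k <- w) step k == 0)
     walk_weight A B C w.

(* The coefficient of x^i in \sum_n (A x + B + C x^-1)^n z^n: a walk from i
   to 0 has exactly i more steps -1 (weight A) than steps 1 (weight C). *)
Definition walk_series (F : fieldType) (s : nat) (A B C : 'M[F]_s) (i : int)
  : 'M[fps F]_s :=
  \matrix_(a, b) Fps (fun n => walk_sum A B C i n a b).

Definition rational_functions (F : fieldType) : set {fraction fps F} :=
  [set u | exists p q : {poly F},
     q != 0 /\ u = tofrac (fps_poly p) / tofrac (fps_poly q)]%classic.

Definition generated_subfield (K : fieldType) (S : set K) : set K :=
  [set x | forall k : {pred K}, GRing.divring_closed k ->
     (forall u, S u -> u \in k) -> x \in k]%classic.

Definition walk_field (F : fieldType) (s : nat) (A B C : 'M[F]_s)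
  : set {fraction fps F} :=
  generated_subfield
    (@rational_functions F `|`
     [set u | exists (i : int) (a b : 'I_s),
        i \in [:: 0; 1; -1] /\ u = tofrac (walk_series A B C i a b)])%classic.

Definition eventually_polynomial (F : fieldType) (f : nat -> F) : Prop :=
  exists (p : {poly F}) (N : nat), forall k, (N <= k)%N -> f k = p.[k%:R].

Definition basis_of_subspace (F : fieldType) (X : lmodType F) (d : nat)
    (Y : set X) (b : 'I_d -> X) : Prop :=
  (forall x, Y x <-> exists c : 'I_d -> F, x = \sum_m c m *: b m) /\
  (forall c : 'I_d -> F, \sum_m c m *: b m = 0 -> forall m, c m = 0).

(* Rows and columns are numbered from 1; entries with a zero index are
   irrelevant. *)
Definition banded_periodic (F : fieldType) (s : nat) (V : nat -> nat -> F)
    (A B C D : 'M[F]_s) : Prop :=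
  [/\ forall i j, (0 < i)%N -> (0 < j)%N ->
        (i <= s)%N && (2 * s < j)%N || (j <= s)%N && (2 * s < i)%N ->
        V i j = 0,
      forall i j, (0 < i)%N -> (0 < j)%N -> (s + 2 <= i + j)%N ->
        V (i + s)%N (j + s)%N = V i j
    & forall i j : 'I_(s + s), V i.+1 j.+1 = block_mx D C A B i j].

(* Main.v *)
From HB Require Import structures.
Require Import Defs.
From mathcomp Require Import all_boot all_order all_algebra.
From mathcomp Require Import boolp classical_sets fsbigop.
From mathcomp Require Import zify.

Set Implicit Arguments.
Unset Strict Implicit.
Unset Printing Implicit Defensive.

Import GRing.Theory.
Local Open Scope ring_scope.

(** Split V into s by s blocks.  The blocks g_k of the first column of
    (1 - zV)^-1 satisfy g_(k+1) = z (A g_k + B g_(k+1) + C g_(k+2)), a system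
    whose solution is determined by its block 0; hence g_(k+1) = L g_k for one
    matrix L with zero constant term.  The walk series M_0, M_1, M_2, ... solve
    the same system, so L = M_1 M_0^-1 has entries in the field, and so has
    g_0, as (1 - z (D + C L)) g_0 is constant.  For a polynomial q, a summation
    by parts reduces the sum of q(k) g_k = q(k) L^k g_0 to q(k+1) - q(k), which
    has smaller degree; no division by integers occurs, so the characteristic
    is irrelevant.  Finally T^n E_1 is a combination of the E_i plus an element
    of Y whose coordinates have generating functions solving
    w = z (tau w + gamma), where tau is the matrix of T on Y and the entries of
    gamma are such weighted sums. *)

(** * Coefficients of matrices of power series *)

Section SeriesMatrices.
Variable F : fieldType.

Definition coefmx m n (k : nat) (P : 'M[fps F]_(m, n)) : 'M[F]_(m, n) :=
  \matrix_(i, j) fps_coef (P i j) k.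

Definition sermx m n (a : nat -> 'M[F]_(m, n)) : 'M[fps F]_(m, n) :=
  \matrix_(i, j) Fps (fun k => a k i j).

Definition constmx m n (P : 'M[F]_(m, n)) : 'M[fps F]_(m, n) :=
  \matrix_(i, j) fps_poly (P i j)%:P.

Definition fpsX : fps F := fps_poly 'X.

Lemma coefmxP m n (P Q : 'M[fps F]_(m, n)) :
  (forall k, coefmx k P = coefmx k Q) -> P = Q.
Proof.
move=> PQ; apply/matrixP => i j; apply: fpsP => k.
by have /matrixP/(_ i j) := PQ k; rewrite !mxE.
Qed.

Lemma coef_sermx m n (a : nat -> 'M[F]_(m, n)) k : coefmx k (sermx a) = a k.
Proof. by apply/matrixP => i j; rewrite !mxE. Qed.

Lemma fps_coefM (f g : fps F) k :
  fps_coef (f * g) k = \sum_(i < k.+1) fps_coef f i * fps_coef g (k - i)%N.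
Proof. by []. Qed.

Lemma fps_coef_sum I (r : seq I) (P : pred I) (f : I -> fps F) k :
  fps_coef (\sum_(i <- r | P i) f i) k = \sum_(i <- r | P i) fps_coef (f i) k.
Proof. by apply: (big_morph (fun g : fps F => fps_coef g k)). Qed.

Lemma coefmxD m n (P Q : 'M[fps F]_(m, n)) k :
  coefmx k (P + Q) = coefmx k P + coefmx k Q.
Proof. by apply/matrixP => i j; rewrite !mxE. Qed.

Lemma coefmxB m n (P Q : 'M[fps F]_(m, n)) k :
  coefmx k (P - Q) = coefmx k P - coefmx k Q.
Proof. by apply/matrixP => i j; rewrite !mxE. Qed.

Lemma coefmxM m n p (P : 'M[fps F]_(m, n)) (Q : 'M[fps F]_(n, p)) k :
  coefmx k (P *m Q) = \sum_(i < k.+1) coefmx i P *m coefmx (k - i) Q.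
Proof.
apply/matrixP => i j; rewrite !mxE fps_coef_sum summxE.
under eq_bigr do rewrite fps_coefM.
rewrite exchange_big /=; apply: eq_bigr => t _; rewrite !mxE.
by apply: eq_bigr => a _; rewrite !mxE.
Qed.

Lemma coefmx1 n k :
  coefmx k (1%:M : 'M[fps F]_n) = if k is 0%N then 1%:M else 0.
Proof.
by apply/matrixP => i j; case: k => [|k]; rewrite !mxE; case: (i == j);
  rewrite //= coef1.
Qed.

Lemma coef_constmx m n (P : 'M[F]_(m, n)) k :
  coefmx k (constmx P) = if k is 0%N then P else 0.
Proof.
by apply/matrixP => i j; rewrite !mxE /= coefC; case: k => [|k]; rewrite ?mxE.
Qed.

Lemma coef_constmxM m n p (P : 'M[F]_(m, n)) (Q : 'M[fps F]_(n, p)) k :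
  coefmx k (constmx P *m Q) = P *m coefmx k Q.
Proof.
rewrite coefmxM big_ord_recl coef_constmx subn0 big1 ?addr0 // => i _.
by rewrite coef_constmx mul0mx.
Qed.

Lemma fps_coefXM (f : fps F) k :
  fps_coef (fpsX * f) k = if k is j.+1 then fps_coef f j else 0.
Proof.
rewrite fps_coefM; case: k => [|k]; rewrite big_ord_recl /= coefX mul0r add0r.
  by rewrite big_ord0.
rewrite big_ord_recl /= coefX mul1r big1 ?addr0 ?subSS ?subn0 // => i _.
by rewrite coefX mul0r.
Qed.

Lemma coefmxX m n (P : 'M[fps F]_(m, n)) k :
  coefmx k (fpsX *: P) = if k is j.+1 then coefmx j P else 0.
Proof.
by apply/matrixP => i j; rewrite !mxE fps_coefXM; case: k => [|k]; rewrite !mxE.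
Qed.

Definition const_coef (f : fps F) : F := fps_coef f 0.

Lemma const_coef_zmod_morphism : zmod_morphism const_coef.
Proof. by []. Qed.

Lemma const_coef_monoid_morphism : monoid_morphism const_coef.
Proof.
by split=> [|f g]; rewrite /const_coef /=; [rewrite coef1 | rewrite big_ord1].
Qed.

HB.instance Definition _ :=
  GRing.isZmodMorphism.Build (fps F) F const_coef const_coef_zmod_morphism.
HB.instance Definition _ :=
  GRing.isMonoidMorphism.Build (fps F) F const_coef const_coef_monoid_morphism.

(** Taking constant coefficients is a ring morphism, hence commutes with the determinant. *)
Lemma det_coefmx0 n (P : 'M[fps F]_n) : coefmx 0 P = 1%:M -> \det P != 0.
Proof.
move=> P1; apply/eqP => dP.
have /(congr1 determinant) : map_mx const_coef P = 1%:M.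
  by rewrite -P1; apply/matrixP => i j; rewrite !mxE.
by rewrite det_map_mx dP det1 => /esym/eqP; rewrite oner_eq0.
Qed.

End SeriesMatrices.

(** * Linear algebra over the series lying in a subfield of the fraction field *)

Section Subfield.
Variables (F : fieldType) (S : divringClosed {fraction fps F}).

Definition series_in : {pred fps F} := fun f => tofrac f \in S.

Fact series_in_subring : subring_closed series_in.
Proof.
split=> [|f g fS gS|f g fS gS]; rewrite unfold_in.
- by rewrite rmorph1 rpred1.
- by rewrite rmorphB rpredB.
- by rewrite rmorphM rpredM.
Qed.

HB.instance Definition _ :=
  GRing.isSubringClosed.Build (fps F) series_in series_in_subring.

Lemma det_series_in n (P : 'M[fps F]_n) :
  P \is a mxOver series_in -> \det P \in series_in.
Proof.
move=> /mxOverP PS; apply: rpred_sum => s _; apply: rpredM.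
  by rewrite rpredX // rpredN rpred1.
exact: rpred_prod.
Qed.

Lemma adj_series_in n (P : 'M[fps F]_n) :
  P \is a mxOver series_in -> \adj P \is a mxOver series_in.
Proof.
move=> /mxOverP PS; apply/mxOverP => i j; rewrite mxE; apply: rpredM.
  by rewrite rpredX // rpredN rpred1.
by apply: det_series_in; apply/mxOverP => a b; rewrite !mxE.
Qed.

Lemma addmx_series_in m n (P Q : 'M[fps F]_(m, n)) :
  P \is a mxOver series_in -> Q \is a mxOver series_in ->
  P + Q \is a mxOver series_in.
Proof. exact: rpredD. Qed.

Lemma subrmx_series_in n (P : 'M[fps F]_n) :
  P \is a mxOver series_in -> 1%:M - P \is a mxOver series_in.
Proof. by apply: rpredB; apply: mxOver_scalar; rewrite ?rpred0 ?rpred1. Qed.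

Lemma mulmx_series_in m n p (P : 'M[fps F]_(m, n)) (Q : 'M[fps F]_(n, p)) :
  P \is a mxOver series_in -> Q \is a mxOver series_in ->
  P *m Q \is a mxOver series_in.
Proof. exact: mxOverM. Qed.

Lemma trmx_series_in m n (P : 'M[fps F]_(m, n)) :
  P \is a mxOver series_in -> P^T \is a mxOver series_in.
Proof. by move=> /mxOverP PS; apply/mxOverP => i j; rewrite mxE. Qed.

(** The quotient is formed among fractions, so [f] need not be invertible as a power series. *)
Lemma series_in_div (f g : fps F) :
  f != 0 -> f \in series_in -> f * g \in series_in -> g \in series_in.
Proof.
move=> f0 fS fgS; rewrite unfold_in.
have -> : tofrac g = tofrac (f * g) / tofrac f.
  by rewrite rmorphM mulrAC divff ?mul1r // tofrac_eq0.
by rewrite rpred_div.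
Qed.

(* Cramer's rule, in the field of fractions. *)
Lemma solve_series_in m n (P : 'M[fps F]_n) (Q : 'M[fps F]_(n, m)) :
  coefmx 0 P = 1%:M -> P \is a mxOver series_in ->
  P *m Q \is a mxOver series_in -> Q \is a mxOver series_in.
Proof.
move=> P1 PS PQS; apply/mxOverP => i j.
apply: (series_in_div (det_coefmx0 P1) (det_series_in PS)).
have /matrixP/(_ i j) : \adj P *m (P *m Q) = \det P *: Q.
  by rewrite mulmxA mul_adj_mx mul_scalar_mx.
by rewrite [RHS]mxE => <-; apply/mxOverP/mxOverM => //; apply: adj_series_in.
Qed.

Hypothesis ratS : forall p : {poly F}, fps_poly p \in series_in.

Lemma constmx_series_in m n (P : 'M[F]_(m, n)) :
  constmx P \is a mxOver series_in.
Proof. by apply/mxOverP => i j; rewrite mxE; apply: ratS. Qed.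

Lemma scaleX_series_in m n (P : 'M[fps F]_(m, n)) :
  P \is a mxOver series_in -> fpsX F *: P \is a mxOver series_in.
Proof.
by move=> /mxOverP PS; apply/mxOverP => i j; rewrite mxE rpredM //; apply: ratS.
Qed.

End Subfield.

(** * The half-line system, its transfer matrix and the walk series *)

Section HalfLine.
Variables (F : fieldType) (s : nat) (A B C : 'M[F]_s).

(* Blocks k >= 1 of (1 - zV) x = 0, where x has blocks x 0, x 1, ... *)
Definition half_line q (x : nat -> 'M[fps F]_(s, q)) : Prop := forall k,
  x k.+1 =
    fpsX F *: (constmx A *m x k + constmx B *m x k.+1 + constmx C *m x k.+2).

(** The factor z makes coefficient n+1 of a block depend only on coefficients n of that block and
    its neighbours, so induction on n treats all blocks at once. *)
Lemma half_line_unique q (x x' : nat -> 'M[fps F]_(s, q)) :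
  half_line x -> half_line x' -> x 0%N = x' 0%N -> forall k, x k = x' k.
Proof.
move=> hx hx' x0 k; apply: coefmxP => n; elim: n k => [|n IHn] [|k];
  rewrite ?x0 // hx hx' !coefmxX //.
by rewrite !coefmxD !coef_constmxM !IHn.
Qed.

(* The solution of the half-line system with identity matrix in block 0. *)
Fixpoint transfer_coef n k : 'M[F]_s :=
  match n, k with
  | 0%N, 0%N => 1%:M
  | m.+1, j.+1 =>
    A *m transfer_coef m j + B *m transfer_coef m k + C *m transfer_coef m k.+1
  | _, _ => 0
  end.

Definition transfer k := sermx (fun n => transfer_coef n k).

Lemma half_line_transfer q (x : nat -> 'M[fps F]_(s, q)) k :
  half_line x -> x k = transfer k *m x 0%N.
Proof.
move=> hx; move: k; apply: half_line_unique => // [k|].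
  have tE : transfer k.+1 = fpsX F *: (constmx A *m transfer k
      + constmx B *m transfer k.+1 + constmx C *m transfer k.+2).
    apply: coefmxP => n; rewrite coefmxX coef_sermx; case: n => [|n] //=.
    by rewrite !coefmxD !coef_constmxM !coef_sermx.
  by rewrite [in LHS]tE -scalemxAl !mulmxDl !mulmxA.
suff -> : transfer 0 = 1%:M by rewrite mul1mx.
by apply: coefmxP => n; rewrite coefmx1 coef_sermx; case: n.
Qed.

(** The system is invariant under translation of blocks, so the matrix L above is [transfer 1]. *)
Lemma half_line_succ q (x : nat -> 'M[fps F]_(s, q)) k :
  half_line x -> x k.+1 = transfer 1 *m x k.
Proof.
move=> hx; have := @half_line_transfer q (fun j => x (k + j)%N) 1%N.
rewrite addn1 addn0; apply=> j.
by rewrite !addnS; exact: hx.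
Qed.

Lemma walk_sum0 i : walk_sum A B C i 0 = if i == 0 then 1%:M else 0.
Proof.
transitivity (\sum_(w : 0.-tuple 'I_3 | i == 0) (1%:M : 'M[F]_s)).
  by apply: eq_big => [w|w _]; rewrite /walk_weight (tuple0 w) big_nil ?addr0.
case: eqP => _; last by rewrite big_pred0.
by rewrite sumr_const card_tuple.
Qed.

(** Walks are sorted by their first step, whose weight is the leftmost factor. *)
Lemma walk_sumS i n : walk_sum A B C i n.+1 =
  A *m walk_sum A B C (i - 1) n + B *m walk_sum A B C i n
    + C *m walk_sum A B C (i + 1) n.
Proof.
rewrite {1}/walk_sum
  (reindex (fun p : 'I_3 * n.-tuple 'I_3 => cons_tuple p.1 p.2)) /=; last first.
  exists (fun w : n.+1.-tuple 'I_3 => (thead w, behead_tuple w)) =>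
    [[k w] _|w _].
    by rewrite theadE; congr (_, _); apply: val_inj.
  by rewrite [RHS]tuple_eta; apply: val_inj.
rewrite -(pair_big_dep xpredT
  (fun k (w : n.-tuple 'I_3) => i + \sum_(j <- k :: w) step j == 0)
  (fun k w => walk_weight A B C (cons_tuple k w))) /=.
have wE (k : 'I_3) :
    \sum_(w : n.-tuple 'I_3 | i + \sum_(j <- k :: w) step j == 0)
      walk_weight A B C (cons_tuple k w)
    = step_weight A B C k *m walk_sum A B C (i + step k) n.
  rewrite mulmx_sumr; apply: eq_big => [w|w _]; rewrite ?big_cons ?addrA //.
  by rewrite /walk_weight big_cons.
rewrite !big_ord_recl big_ord0 !wE /= addr0 addrA /step /= addr0.
by [].
Qed.

(** The start [k.+1] is not 0, so the empty walk contributes nothing and the first-step recurrence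
    is the whole system. *)
Lemma half_line_walk_series :
  half_line (fun k : nat => walk_series A B C k%:Z).
Proof.
move=> k; apply: coefmxP => n; rewrite coefmxX coef_sermx.
case: n => [|n]; first by rewrite walk_sum0.
rewrite !coefmxD !coef_constmxM !coef_sermx walk_sumS.
have -> : k.+1%:Z - 1 = k%:Z by rewrite -addn1 PoszD addrK.
by rewrite -PoszD addn1.
Qed.

Lemma walk_series0_const : coefmx 0 (walk_series A B C 0) = 1%:M.
Proof. by rewrite coef_sermx walk_sum0. Qed.

Lemma transfer_const : coefmx 0 (transfer 1) = 0.
Proof. by rewrite coef_sermx. Qed.

End HalfLine.

(** For [p * 'X + c%:P] the difference is that of [p] times ['X], plus the shifted [p]; neither
    exceeds the size of [p], in any characteristic. *)
Lemma size_poly_difference (R : idomainType) (p : {poly R}) :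
  (size (p \Po ('X + 1%:P) - p)%R <= (size p).-1)%N.
Proof.
elim/poly_ind: p => [|p c IHp]; first by rewrite comp_poly0 subrr size_poly0.
have [->|p0] := eqVneq p 0.
  by rewrite mul0r add0r comp_polyC subrr size_poly0.
rewrite size_MXaddC (negPf p0) /= comp_polyD comp_polyM comp_polyX comp_polyC.
have -> : (p \Po ('X + 1%:P)) * ('X + 1%:P) + c%:P - (p * 'X + c%:P) =
    (p \Po ('X + 1%:P) - p) * 'X + (p \Po ('X + 1%:P)).
  by rewrite opprD addrACA subrr addr0 mulrDr mulrBl polyC1 mulr1 addrAC.
apply: leq_trans (size_polyD _ _) _; rewrite geq_max.
rewrite size_comp_poly2 ?size_XaddC // leqnn andbT.
apply: leq_trans (size_polyMleq _ _) _; rewrite size_polyX addnS addn1 /=.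
by apply: leq_ltn_trans IHp _; rewrite ltn_predL size_poly_gt0.
Qed.

(** * The resolvent of V and weighted sums of its blocks *)

Section Resolvent.
Variables (F : fieldType) (s : nat) (A B C D : 'M[F]_s) (v : 'cV[F]_s).

(* Block k of V^n v, with v placed in block 0. *)
Fixpoint power_block n k : 'cV[F]_s :=
  match n, k with
  | 0%N, 0%N => v
  | 0%N, _ => 0
  | m.+1, 0%N => D *m power_block m 0 + C *m power_block m 1
  | m.+1, j.+1 =>
    A *m power_block m j + B *m power_block m k + C *m power_block m k.+1
  end.

(** One application of V reaches at most one block further. *)
Lemma power_block_gt n k : (n < k)%N -> power_block n k = 0.
Proof.
elim: n k => [|n IHn] [|k] //= nk.
by rewrite !IHn ?mulmx0 ?addr0 // ltnW // ltnW.
Qed.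

Definition resolvent_block k := sermx (fun n => power_block n k).

Lemma half_line_resolvent : half_line A B C resolvent_block.
Proof.
move=> k; apply: coefmxP => n; rewrite coefmxX coef_sermx; case: n => [|n] //=.
by rewrite !coefmxD !coef_constmxM !coef_sermx.
Qed.

Lemma resolvent_block0 :
  resolvent_block 0 = constmx v + fpsX F *:
    (constmx D *m resolvent_block 0 + constmx C *m resolvent_block 1).
Proof.
apply: coefmxP => n; rewrite coefmxD coefmxX coef_constmx coef_sermx.
case: n => [|n] /=; first by rewrite addr0.
by rewrite coefmxD !coef_constmxM !coef_sermx add0r.
Qed.

(* The sum over all k of q k times block k of (1 - zV)^-1 v: the blocks k > n
   of V^n v vanish. *)
Definition weighted_sum (q : nat -> F) : 'cV[fps F]_s :=
  sermx (fun n => \sum_(k < n.+1) q k *: power_block n k).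

Lemma weighted_sum_widen (q : nat -> F) n m : (n < m)%N ->
  \sum_(k < n.+1) q k *: power_block n k = \sum_(k < m) q k *: power_block n k.
Proof.
move=> nm; rewrite (big_ord_widen m (fun k => q k *: power_block n k)) //.
rewrite big_mkcond /=; apply: eq_bigr => k _; case: ltnP => // nk.
by rewrite power_block_gt ?scaler0.
Qed.

Lemma weighted_sumD (q r : nat -> F) :
  weighted_sum (fun k => q k + r k) = weighted_sum q + weighted_sum r.
Proof.
apply: coefmxP => n; rewrite coefmxD !coef_sermx -big_split /=.
by apply: eq_bigr => k _; rewrite scalerDl.
Qed.

(** Once block 0 is split off, every remaining block is L times its predecessor, and L factors out
    of the sum. *)
Lemma weighted_sum_shift (q : nat -> F) :
  weighted_sum q = constmx (q 0%N)%:M *m resolvent_block 0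
    + transfer A B C 1 *m weighted_sum (fun k => q k.+1).
Proof.
apply: coefmxP => n; rewrite coefmxD coef_constmxM !coef_sermx mul_scalar_mx.
(* The added term vanishes; with it, n+1 terms remain after the removal of block 0. *)
rewrite (weighted_sum_widen _ (leqnSn n.+1)) big_ord_recl /=; congr (_ + _).
under eq_bigr => k _ do
  rewrite -[power_block n k.+1](coef_sermx (fun m => power_block m k.+1))
    -/(resolvent_block k.+1) (half_line_succ k half_line_resolvent) coefmxM
    scaler_sumr.
rewrite exchange_big coefmxM; apply: eq_bigr => t _.
rewrite [coefmx _ (weighted_sum _)]coef_sermx.
have /= -> := @weighted_sum_widen (fun k => q k.+1) _ n.+1 (leq_subr t n).
rewrite mulmx_sumr; apply: eq_bigr => k _.
by rewrite -scalemxAr [coefmx _ (resolvent_block _)]coef_sermx.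
Qed.

Variable S : divringClosed {fraction fps F}.
Local Notation overS := (mxOver (series_in S)).
Hypothesis ratS : forall p : {poly F}, fps_poly p \in series_in S.
Hypothesis walk0S : walk_series A B C 0 \is a overS.
Hypothesis walk1S : walk_series A B C 1 \is a overS.

(** M_1 = L M_0, and M_0 has constant term 1. Transposing turns the right factor M_0 into a left
    one, as [solve_series_in] requires. *)
Lemma transfer_series_in : transfer A B C 1 \is a overS.
Proof.
rewrite -[transfer _ _ _ _]trmxK; apply: trmx_series_in.
apply: (@solve_series_in _ _ _ _ (walk_series A B C 0)^T).
- rewrite -[RHS]trmx1 -(walk_series0_const A B C).
  by apply/matrixP => i j; rewrite !mxE.
- exact: trmx_series_in.
- rewrite -trmx_mul; apply: trmx_series_in.
  by rewrite -(half_line_succ 0 (@half_line_walk_series _ _ A B C)).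
Qed.

Lemma resolvent_block0_series_in : resolvent_block 0 \is a overS.
Proof.
have ctS := constmx_series_in ratS.
have LS := transfer_series_in.
(* Substituting g_1 = L g_0 into the equation of block 0 turns it into [P] times g_0 equals
   [constmx v]. *)
pose P := 1%:M - fpsX F *: (constmx D + constmx C *m transfer A B C 1).
apply: (@solve_series_in _ _ _ _ P).
- by rewrite coefmxB coefmx1 coefmxX subr0.
- apply: subrmx_series_in; apply: scaleX_series_in => //.
  by apply: addmx_series_in => //; apply: mulmx_series_in.
- suff -> : P *m resolvent_block 0 = constmx v by [].
  rewrite mulmxBl mul1mx -scalemxAl mulmxDl -mulmxA.
  rewrite -(half_line_succ 0 half_line_resolvent) [X in X - _]resolvent_block0.
  by rewrite addrK.
Qed.

(** Writing W(p) for the weighted sum and p' = p(X+1) - p, the shift formula gives (1 - L) W(p) =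
    p(0) g_0 + L W(p'), where 1 - L has constant term 1. *)
Lemma weighted_sum_poly_series_in (p : {poly F}) :
  weighted_sum (fun k => p.[k%:R]) \is a overS.
Proof.
have LS := transfer_series_in.
move: {2}(size p) (leqnn (size p)) => n; elim: n p => [|n IHn] p size_p.
  move: size_p; rewrite leqn0 size_poly_eq0 => /eqP ->.
  suff -> : weighted_sum (fun k : nat => (0 : {poly F}).[k%:R]) = 0.
    by rewrite rpred0.
  apply: coefmxP => m; rewrite coef_sermx big1 => [|k _].
    by apply/matrixP => i j; rewrite !mxE.
  by rewrite horner0 scale0r.
pose p' := p \Po ('X + 1%:P) - p.
have p'S : weighted_sum (fun k => p'.[k%:R]) \is a overS.
  apply: IHn; apply: leq_trans (size_poly_difference p) _.
  by move: size_p; case: (size p).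
apply: (@solve_series_in _ _ _ _ (1%:M - transfer A B C 1)).
- by rewrite coefmxB coefmx1 transfer_const subr0.
- exact: subrmx_series_in.
- rewrite mulmxBl mul1mx {1}weighted_sum_shift.
  have -> : (fun k : nat => p.[k.+1%:R]) =
      (fun k : nat => p.[k%:R] + p'.[k%:R]).
    apply/funext => k; rewrite [p'.[_]]hornerD hornerN horner_comp hornerD.
    by rewrite hornerX hornerC natr1 [RHS]addrC subrK.
  rewrite (weighted_sumD (fun k => p.[k%:R]) (fun k => p'.[k%:R])) mulmxDr.
  rewrite (addrC (_ *m weighted_sum (fun k => p.[k%:R]))) addrA addrK.
  by apply: addmx_series_in; apply: mulmx_series_in => //;
    [apply: constmx_series_in | apply: resolvent_block0_series_in].
Qed.

(** Each use of the shift formula lowers the threshold [N] by one and translates the polynomial. *)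
Lemma weighted_sum_series_in (q : nat -> F) :
  eventually_polynomial q -> weighted_sum q \is a overS.
Proof.
case=> p [N]; elim: N q p => [|N IHN] q p qp.
  suff -> : q = (fun k => p.[k%:R]) by apply: weighted_sum_poly_series_in.
  by apply/funext => k; apply: qp.
rewrite weighted_sum_shift; apply: addmx_series_in; apply: mulmx_series_in.
- exact: constmx_series_in.
- exact: resolvent_block0_series_in.
- exact: transfer_series_in.
- apply: (IHN _ (p \Po ('X + 1%:P))) => k Nk.
  by rewrite qp ?ltnS // horner_comp hornerD hornerX hornerC natr1.
Qed.

End Resolvent.

(** * The action of T on blocks of the E_i *)

Lemma big_ord_blocks (M : nmodType) (s K : nat) (f : nat -> M) :
  \sum_(i < s * K) f i = \sum_(k < K) \sum_(i < s) f (i + s * k)%N.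
Proof.
elim: K => [|K IHK]; first by rewrite muln0 !big_ord0.
rewrite mulnSr big_split_ord big_ord_recr IHK /=; congr (_ + _).
by apply: eq_bigr => i _; rewrite addnC.
Qed.

(** The left side groups terms by source block, the right side by target block; [a], [b], [c], [d]
    stand for the contributions of A, B, C, D. *)
Lemma band_sum (M : zmodType) (a b c : nat -> M) (d : M) n :
  b n.+1 = 0 -> c n = 0 -> c n.+1 = 0 ->
  d + a 0%N + \sum_(k < n) (c k + b k.+1 + a k.+1)
    = d + c 0%N + \sum_(k < n.+1) (a k + b k.+1 + c k.+1).
Proof.
move=> bn cn cn1; rewrite !big_split /= big_ord_recl.
have -> : \sum_(k < n.+1) b k.+1 = \sum_(k < n) b k.+1.
  by rewrite big_ord_recr /= bn addr0.
have -> : \sum_(k < n) c k = c 0%N + \sum_(k < n.+1) c k.+1.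
  rewrite -(big_ord_recl n.+1 (fun k : 'I_n.+2 => c k)) !big_ord_recr /=.
  by rewrite cn cn1 !addr0.
by rewrite (AC (2*4) ((1*3)*(2*6*5*4))).
Qed.

Section BlockAction.
Variables (F : fieldType) (s : nat) (V : nat -> nat -> F) (A B C D : 'M[F]_s).
Hypothesis hV : banded_periodic V A B C D.
Variables (X : lmodType F) (T : {linear X -> X}) (E y : nat -> X).
Hypothesis hE : forall j, (1 <= j)%N ->
  T (E j) = \sum_(i \in [set i | (1 <= i)%N]%classic) (V i j *: E i) + y j.

(** The index is [i.+1] because sequences are numbered from 1; [G] is the sequence [E] or [y]. *)
Definition block_comb (G : nat -> X) k (v : 'cV[F]_s) : X :=
  \sum_(i < s) v i 0 *: G (i.+1 + s * k)%N.

Lemma block_comb_is_linear G k : linear (block_comb G k).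
Proof.
move=> a u v; rewrite scaler_sumr -big_split; apply: eq_bigr => i _ /=.
by rewrite !mxE scalerDl scalerA.
Qed.

HB.instance Definition _ G k := GRing.isLinear.Build F 'cV[F]_s X *:%R
  (block_comb G k) (block_comb_is_linear G k).

Lemma block_comb_mulmx G k (P : 'M[F]_s) (v : 'cV[F]_s) :
  block_comb G k (P *m v) = \sum_j v j 0 *: block_comb G k (col j P).
Proof.
have -> : P *m v = \sum_j v j 0 *: col j P.
  apply/matrixP => i j; rewrite !ord1 !mxE summxE.
  by apply: eq_bigr => t _; rewrite !mxE mulrC.
by rewrite linear_sum; apply: eq_bigr => j _; rewrite linearZ.
Qed.

Lemma V_shift i j k : (0 < i)%N -> (0 < j)%N -> (s + 2 <= i + j)%N ->
  V (i + s * k)%N (j + s * k)%N = V i j.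
Proof.
case: hV => _ Vper _ i0 j0 ij; elim: k => [|k IHk].
  by rewrite muln0 !addn0.
rewrite mulnSr !addnA Vper ?IHk ?addn_gt0 ?i0 ?j0 //.
by apply: leq_trans ij _; apply: leq_add; rewrite leq_addr.
Qed.

Lemma VD (i j : 'I_s) : V i.+1 j.+1 = D i j.
Proof.
by case: hV => _ _ /(_ (lshift s i) (lshift s j)); rewrite block_mxEul.
Qed.

Lemma VC (i j : 'I_s) : V i.+1 (s + j).+1 = C i j.
Proof.
by case: hV => _ _ /(_ (lshift s i) (rshift s j)); rewrite block_mxEur.
Qed.

Lemma VA (i j : 'I_s) : V (s + i).+1 j.+1 = A i j.
Proof.
by case: hV => _ _ /(_ (rshift s i) (lshift s j)); rewrite block_mxEdl.
Qed.

Lemma VB (i j : 'I_s) : V (s + i).+1 (s + j).+1 = B i j.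
Proof.
by case: hV => _ _ /(_ (rshift s i) (rshift s j)); rewrite block_mxEdr.
Qed.

Lemma T_column j K : (1 <= j)%N -> (forall i, (s * K < i)%N -> V i j = 0) ->
  T (E j) = \sum_(k < K) block_comb E k (\col_i V (i.+1 + s * k)%N j) + y j.
Proof.
move=> j1 VK; rewrite hE //; congr (_ + _).
rewrite (fsbigE (index_iota 1 (s * K).+1)) ?iota_uniq //; first last.
- move=> i /= i1; rewrite mem_index_iota i1 /= -leqNgt => /VK ->.
  by rewrite scale0r.
- by move=> i /=; rewrite mem_index_iota => /andP[].
rewrite big_seq_cond.
under eq_bigl => i.
  rewrite andb_idr; first over.
  by rewrite mem_index_iota => /andP[i1 _]; rewrite inE.
rewrite -big_seq big_add1 /= big_mkord.
rewrite (big_ord_blocks s K (fun i => V i.+1 j *: E i.+1)).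
by apply: eq_bigr => k _; apply: eq_bigr => i _; rewrite mxE.
Qed.

Lemma T_block0 (v : 'cV[F]_s) : T (block_comb E 0 v) =
  block_comb E 0 (D *m v) + block_comb E 1 (A *m v) + block_comb y 0 v.
Proof.
rewrite !block_comb_mulmx linear_sum -!big_split; apply: eq_bigr => j _ /=.
rewrite linearZ -!scalerDr; congr (_ *: _).
(* The first s columns of V vanish below row 2s, so two blocks suffice. *)
rewrite (@T_column _ 2) ?muln0 ?addn0 // => [|i Hi]; last first.
  by case: hV => -> //; [case: i Hi | rewrite ltn_ord [(2 * s)%N]mulnC Hi orbT].
congr (_ + _); rewrite !big_ord_recl big_ord0 addr0 /=.
congr (block_comb _ _ _ + block_comb _ _ _); apply/colP => i; rewrite !mxE.
  by rewrite muln0 addn0 VD.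
by rewrite muln1 addSn addnC VA.
Qed.

Lemma T_blockS k (v : 'cV[F]_s) : T (block_comb E k.+1 v) =
  block_comb E k (C *m v) + block_comb E k.+1 (B *m v)
    + block_comb E k.+2 (A *m v) + block_comb y k.+1 v.
Proof.
rewrite !block_comb_mulmx linear_sum -!big_split; apply: eq_bigr => j _ /=.
rewrite linearZ -!scalerDr; congr (_ *: _).
case: (hV) => Vband Vper _.
(* Shifting back by k+1 blocks puts the column among the first s and the row beyond 2s. *)
rewrite (@T_column _ k.+3) // => [|i Hi]; last first.
  have si : (s * k.+1 <= i)%N by lia.
  rewrite -(subnK si) V_shift; try lia.
  by apply: Vband; have := ltn_ord j; lia.
congr (_ + _); rewrite !big_ord_recr /= big1 ?add0r => [|p _]; last first.
  rewrite [X in block_comb _ _ X](_ : _ = 0) ?linear0 //; apply/colP => i.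
  have pk := ltn_ord p; have [is_ js] := (ltn_ord i, ltn_ord j).
  (* Shifted back by p blocks, the row is among the first s and the column beyond 2s, as k+1-p is at
     least 2. *)
  have -> : (j.+1 + s * k.+1 = (j.+1 + s * (k.+1 - p)) + s * p)%N.
    by rewrite -addnA -mulnDr subnK // ltnW // ltnS ltnW.
  rewrite !mxE V_shift //; last by rewrite mulnBr; nia.
  by apply: Vband => //; nia.
congr (block_comb _ _ _ + block_comb _ _ _ + block_comb _ _ _);
  apply/colP => i; rewrite !mxE.
(* In C the smallest index sum is s+2, exactly the bound for periodicity. *)
- have -> : (j.+1 + s * k.+1 = (s + j).+1 + s * k)%N by lia.
  by rewrite V_shift ?VC //; lia.
(* Only k shifts are undone: one more would reach the corner block D, which may differ from B. *)
- have -> : (j.+1 + s * k.+1 = (s + j).+1 + s * k)%N by lia.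
  have -> : (i.+1 + s * k.+1 = (s + i).+1 + s * k)%N by lia.
  by rewrite V_shift ?VB //; lia.
- have -> : (i.+1 + s * k.+2 = (s + i).+1 + s * k.+1)%N by lia.
  by rewrite V_shift ?VA //; lia.
Qed.

Variable v : 'cV[F]_s.
Local Notation g := (power_block A B C D v).

Definition forcing n : X := \sum_(k < n.+1) block_comb y k (g n k).

(** T acts on the coefficients as V does, up to the terms y_j; regrouping by target block yields the
    recursion of [power_block]. *)
Lemma T_power_block n :
  T (\sum_(k < n.+1) block_comb E k (g n k)) =
    \sum_(k < n.+2) block_comb E k (g n.+1 k) + forcing n.
Proof.
rewrite linear_sum big_ord_recl T_block0.
under eq_bigr do rewrite T_blockS.
rewrite big_split /= addrACA.
rewrite -[X in _ + X](big_ord_recl n (fun k : 'I_n.+1 => block_comb y k (g n k))).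
congr (_ + _).
rewrite [RHS]big_ord_recl /=.
under [in RHS]eq_bigr do rewrite !linearD.
rewrite linearD.
apply: (@band_sum X (fun k => block_comb E k.+1 (A *m g n k))
  (fun k => block_comb E k (B *m g n k))
  (fun k => block_comb E k (C *m g n k.+1)));
  by rewrite power_block_gt ?mulmx0 ?linear0.
Qed.

End BlockAction.

(** * A first-order linear recursion for the coordinates in Y *)

Section FirstOrderSystem.
Variables (F : fieldType) (d : nat) (tau : 'M[F]_d) (gamma : nat -> 'cV[F]_d).

Fixpoint system_solution n : 'cV[F]_d :=
  if n is m.+1 then tau *m system_solution m + gamma m else 0.

Variable S : divringClosed {fraction fps F}.
Hypothesis ratS : forall p : {poly F}, fps_poly p \in series_in S.

(** The recursion reads (1 - z tau) w = z gamma, and the matrix on the left has constant term 1. *)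
Lemma system_solution_series_in :
  sermx gamma \is a mxOver (series_in S) ->
  sermx system_solution \is a mxOver (series_in S).
Proof.
move=> gS; apply: (@solve_series_in _ _ _ _ (1%:M - fpsX F *: constmx tau)).
- by rewrite coefmxB coefmx1 coefmxX subr0.
- apply: subrmx_series_in; apply: scaleX_series_in => //.
  exact: constmx_series_in.
suff -> : (1%:M - fpsX F *: constmx tau) *m sermx system_solution =
    fpsX F *: sermx gamma by apply: scaleX_series_in.
rewrite mulmxBl mul1mx -scalemxAl; apply: coefmxP => n.
rewrite coefmxB !coefmxX !coef_sermx; case: n => [|n]; first by rewrite subr0.
by rewrite coef_constmxM !coef_sermx /= addrAC subrr add0r.
Qed.

End FirstOrderSystem.

(** * The generating function of l(T^n E_1) *)

Theorem theorem5p11 (F : fieldType) (s : nat) (hs : (1 <= s)%N)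
    (V : nat -> nat -> F) (A B C D : 'M[F]_s)
    (hV : banded_periodic V A B C D)
    (X : lmodType F) (Y : set X) (d : nat) (b : 'I_d -> X)
    (hY : basis_of_subspace Y b)
    (T : {linear X -> X}) (hT : forall x, Y x -> Y (T x))
    (E : nat -> X) (y : nat -> X)
    (hE : forall j, (1 <= j)%N ->
       T (E j) = \sum_(i \in [set i | (1 <= i)%N]%classic) (V i j *: E i) + y j)
    (hy : forall j, (1 <= j)%N -> Y (y j))
    (c : nat -> 'I_d -> F)
    (hc : forall j, (1 <= j)%N -> y j = \sum_(m < d) c j m *: b m)
    (hpoly : forall i, (1 <= i <= s)%N -> forall m : 'I_d,
       eventually_polynomial (fun k => c (i + s * k)%N m))
    (l : {scalar X}) (hl : forall i, (1 <= i)%N -> l (E i) = 0) :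
  walk_field A B C (tofrac (Fps (fun n => l (iter n T (E 1%N))))).
Proof.
move=> k kdiv kgen.
(* Membership in [walk_field] is tested against an arbitrary division-closed [k] containing the
   generators. *)
pose S : divringClosed {fraction fps F} :=
  HB.pack (k : {fraction fps F} -> bool) (GRing.isDivringClosed.Build _ k kdiv).
have ratS (p : {poly F}) : fps_poly p \in series_in S.
  apply: kgen; left; exists p, 1; split; first exact: oner_neq0.
  by rewrite [tofrac (fps_poly 1)]rmorph1 divr1.
have walkS (i : int) : i \in [:: 0; 1; -1] ->
    walk_series A B C i \is a mxOver (series_in S).
  by move=> i3; apply/mxOverP => a a'; apply: kgen; right; exists i, a, a'.
case: hY => hY _.
have /boolp.choice[t Tb] m :
    exists tm : 'I_d -> F, T (b m) = \sum_i tm i *: b i.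
  apply/hY/hT/hY; exists (fun i => (i == m)%:R).
  rewrite (bigD1 m) //= eqxx scale1r big1 ?addr0 // => i /negPf ->.
  by rewrite scale0r.
(* This choice makes [block_comb E 0 v] equal to [E 1]. *)
pose v : 'cV[F]_s := \col_i (i == Ordinal hs)%:R.
(* These are coordinates of [forcing] with respect to [b]. *)
pose gamma n : 'cV[F]_d := \col_m
  \sum_(j < n.+1) \sum_(i < s)
    power_block A B C D v n j i 0 * c (i.+1 + s * j)%N m.
pose tau : 'M[F]_d := \matrix_(i, m) t m i.
pose w := system_solution tau gamma.
(* The E-part evolves by V, while the Y-coordinates [w] start at 0 and are driven by [gamma]. *)
have TE n : iter n T (E 1%N) =
    \sum_(j < n.+1) block_comb E j (power_block A B C D v n j)
      + \sum_m w n m 0 *: b m.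
  elim: n => [|n IHn].
    rewrite [X in _ + X]big1 => [|m _]; last by rewrite mxE scale0r.
    rewrite big_ord1 addr0 /block_comb (bigD1 (Ordinal hs)) //= big1 => [|i].
      by rewrite mxE eqxx scale1r muln0 addr0.
    by move=> /negPf ni; rewrite mxE ni scale0r.
  rewrite iterS IHn linearD (T_power_block hV hE) -addrA; congr (_ + _).
  have -> : forcing A B C D y v n = \sum_m gamma n m 0 *: b m.
    under [RHS]eq_bigr do rewrite mxE scaler_suml.
    rewrite exchange_big; apply: eq_bigr => j _ /=.
    under [RHS]eq_bigr do rewrite scaler_suml.
    rewrite exchange_big; apply: eq_bigr => i _ /=.
    by rewrite hc // scaler_sumr; apply: eq_bigr => m _; rewrite scalerA.
  rewrite addrC linear_sum.
  under eq_bigr do rewrite linearZ /= Tb scaler_sumr.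
  rewrite exchange_big -big_split; apply: eq_bigr => m _ /=.
  rewrite [in RHS]mxE [in RHS]mxE scalerDl scaler_suml; congr (_ + _).
  by apply: eq_bigr => i _; rewrite mxE scalerA mulrC.
have gammaS : sermx gamma \is a mxOver (series_in S).
  apply/mxOverP => m j; rewrite {j}ord1.
  (* For each position i inside a block the weights are eventually polynomial by [hpoly]. *)
  suff -> : sermx gamma m 0 = \sum_(i < s)
      weighted_sum A B C D v (fun k => c (i.+1 + s * k)%N m) i 0.
    apply: rpred_sum => i _; apply: mxOverP.
    apply: weighted_sum_series_in => //; try by apply: walkS.
    by apply: hpoly; rewrite /= ltn_ord.
  apply: fpsP => n; rewrite fps_coef_sum !mxE /= mxE exchange_big.
  apply: eq_bigr => i _; rewrite mxE /= summxE; apply: eq_bigr => j _.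
  by rewrite mxE mulrC.
(* Since [l] kills every E_i, the wanted series is the row of the [l (b m)] times [w]. *)
have : constmx (\row_m l (b m)) *m sermx w \is a mxOver (series_in S).
  by apply: mulmx_series_in; [apply: constmx_series_in
    | apply: system_solution_series_in].
move=> /mxOverP/(_ 0 0).
suff -> : (constmx (\row_m l (b m)) *m sermx w) 0 0 =
    Fps (fun n => l (iter n T (E 1%N))) by [].
apply: fpsP => n /=.
have /matrixP/(_ 0 0) := coef_constmxM (\row_m l (b m)) (sermx w) n.
rewrite coef_sermx [LHS]mxE => ->; rewrite TE linearD [l _]linear_sum big1.
  rewrite add0r linear_sum mxE; apply: eq_bigr => m _.
  by rewrite linearZ mxE /= mulrC.
move=> j _; rewrite [l _]linear_sum big1 // => i _.
by rewrite linearZ hl //= mulr0.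
Qed.
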